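(* Let $\mathcal{P}$ be a probability distribution on $\mathbb{R}$ and let $X$ be a random variable with distribution $\mathcal{P}$. Define the tail quantile function $g(p) := \inf\{r \in \mathbb{R} : \mathbb{P}(X \geq r) \leq p\}$ for $0<p<1$. Assume that (1) $\mathbb{E}|X| < \infty$, and (2) $g(p) \to \infty$ as $p \to 0^+$, and $g$ is slowly varying at zero, i.e. $g(\lambda p)/g(p) \to 1$ as $p \to 0^+$ for every fixed $\lambda > 0$. For each $n \in \mathbb{N}$, let $X_1,\dots,X_n$ be i.i.d. with distribution $\mathcal{P}$ and set $M_n = \max_{1\le i\le n} X_i$; also let $(X_{ij})_{1\le i,j\le n}$ be an $n\times n$ random matrix with i.i.d. entries having distribution $\mathcal{P}$, and set $\mathcal{M}_n = \max_{\pi \in SS_n} \sum_{i=1}^n X_{i\pi(i)}$, where $SS_n$ is the set of permutations of $\{1,\dots,n\}$. Then $$\mathbb{E} M_n = g(1/n)(1+o(1)) \quad \text{as } n\to\infty,$$ and $$\mathbb{E} \mathcal{M}_n = n\, g(1/n)(1+o(1)) \quad \text{as } n\to\infty.$$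
   Context: $\{S(\pi)=\sum_{i=1}^n X_{i\pi(i)}, \pi\in SS_n\}$ is called the random assignment process; $\mathcal{M}_n$ is its maximum. *)

(* Defs.v *)
From HB Require Import structures.
From mathcomp Require Import all_boot all_order all_algebra all_fingroup.
From mathcomp Require Import all_classical all_reals all_analysis.
Set Implicit Arguments. Unset Strict Implicit. Unset Printing Implicit Defensive.
Import Order.TTheory GRing.Theory Num.Theory.
Import numFieldNormedType.Exports.
Local Open Scope classical_set_scope.
Local Open Scope ring_scope.

Definition tail_quantile (R : realType) (P : probability (measurableTypeR R) R)
  (p : R) : R := inf [set r : R | (P (`[r, +oo[%classic) <= p%:E)%E].

Definition mutually_independent (d : measure_display) (T : measurableType d)
  (R : realType) (Pr : probability T R) (I : finType) (X : I -> T -> R) : Prop :=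
  forall (J : {set I}) (B : I -> set R),
    (forall i, measurable (B i)) ->
    Pr (\bigcap_(i in [set i | i \in J]) (X i @^-1` B i)) =
      (\prod_(i in J) Pr (X i @^-1` B i))%E.

Definition iid_with_law (d : measure_display) (T : measurableType d)
  (R : realType) (Pr : probability T R) (I : finType) (X : I -> T -> R)
  (P : probability (measurableTypeR R) R) : Prop :=
  (forall i, measurable_fun setT (X i)) /\
  (forall i (B : set R), measurable B -> Pr (X i @^-1` B) = P B) /\
  mutually_independent Pr X.

(* Main.v *)
(** Write g for the tail quantile. Cutting (X - g p)^+ at the levels
g (p / 2^k), slow variation gives E (X - g p)^+ = o(p g p). With a = g (1/n)
this yields both upper bounds, since the maximum is at most
a + sum_i (X_i - a)^+ and the assignment maximum at most
n a + sum_ij (Y_ij - a)^+.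

For the lower bounds let b = g (L / n), which is asymptotic to g (1/n) for fixed
L, while P (X >= b) >= L / n. One of X_1, ..., X_n reaches b with probability at
least 1 - exp (- L). For the matrix, take a permutation with the largest number
of entries reaching b: its rows without such an entry and the images of these
rows span a block all of whose entries are below b. By a union bound, for L
large no block of size m x m, with m close to a small multiple of n, has this
property except with small probability, so at least n - m rows are good. The
permutation can be changed on m rows so that these contribute at least the
average over an m x m block, which costs O(n^2 / m) = O(n) = o(n g (1/n)). *)

Require Import Defs.
From HB Require Import structures.
From mathcomp Require Import all_boot all_order all_algebra all_fingroup.
From mathcomp Require Import ring lra.
Import Order.TTheory GRing.Theory Num.Theory.
Local Open Scope ring_scope.

(** * Permutations *)

Section Assignment.
Context {R : realFieldType} {I : finType}.
Implicit Types (f : I -> I -> R) (s : {perm I}) (A B : {set I}).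

Lemma sum_tperm f s (i j : I) : i != j ->
  \sum_k f k ((tperm i j * s)%g k) =
  \sum_k f k (s k) + (f i (s j) + f j (s i) - f i (s i) - f j (s j)).
Proof.
move=> ij; have ji : j != i by rewrite eq_sym.
rewrite (bigD1 i)//= (bigD1 j)//= !permM tpermL tpermR.
rewrite [X in _ = X + _](bigD1 i)//= [X in _ = _ + X + _](bigD1 j)//=.
rewrite (eq_bigr (fun k => f k (s k))); first by lra.
by move=> k /andP[ki kj]; rewrite permM tpermD// eq_sym.
Qed.

Lemma exists_max_perm f (Q : pred {perm I}) s0 : Q s0 ->
  exists s, Q s /\ forall t, Q t -> \sum_k f k (t k) <= \sum_k f k (s k).
Proof.
move=> Qs0.
case: (@Order.TotalTheory.arg_maxP _ _ _ s0 Q (fun s => \sum_k f k (s k)) Qs0).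
by move=> s Qs smax; exists s; split.
Qed.

(* In a permutation using as many edges as possible, exchanging the images of
   two rows without an edge cannot create an edge. *)
Lemma exists_perm_no_edge (e : rel I) : exists s,
  forall i j, ~~ e i (s i) -> ~~ e j (s j) -> ~~ e i (s j).
Proof.
have [s [_ smax]] := @exists_max_perm (fun i j => (e i j)%:R) predT 1%g isT.
exists s => i j ei ej; apply/negP => eij.
have ij : i != j by apply: contraTneq eij => ->.
have := smax (tperm i j * s)%g isT.
rewrite (sum_tperm (fun i j => (e i j)%:R))// eij (negbTE ei) (negbTE ej) /=.
by case: (e j (s i)) => /=; lra.
Qed.

(* For an optimal [s] this is the inequality saying that exchanging two images
   does not help, summed over all pairs in [A]. *)
Lemma exists_perm_average f s0 A : exists s,
  (forall i, i \notin A -> s i = s0 i) /\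
  \sum_(i in A) \sum_(j in A) f i (s j) <= #|A|%:R * \sum_(i in A) f i (s i).
Proof.
pose Q := [pred s : {perm I} | [forall i, (i \notin A) ==> (s i == s0 i)]].
have Qs0 : Q s0 by apply/forallP => i; apply/implyP.
have [s [/forallP Qs smax]] := @exists_max_perm f Q s0 Qs0.
exists s; split=> [i iA|]; first by apply/eqP; exact: (implyP (Qs i)).
have swap i j : i \in A -> j \in A ->
    f i (s j) + f j (s i) <= f i (s i) + f j (s j).
  move=> iA jA; have [->|ij] := eqVneq i j; first by [].
  have /smax : Q (tperm i j * s)%g.
    apply/forallP => k; apply/implyP => kA; rewrite permM tpermD.
    - exact: (implyP (Qs k)).
    - by apply: contraNneq kA => <-.
    - by apply: contraNneq kA => <-.
  by rewrite sum_tperm//; lra.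
have : \sum_(i in A) \sum_(j in A) (f i (s j) + f j (s i)) <=
       \sum_(i in A) \sum_(j in A) (f i (s i) + f j (s j)).
  by apply: ler_sum => i iA; apply: ler_sum => j jA; exact: swap.
under eq_bigr do rewrite big_split/=.
rewrite big_split/= [X in _ + X <= _]exchange_big/=.
under [X in _ <= X]eq_bigr do rewrite big_split/= sumr_const.
rewrite big_split/= sumr_const sumrMnl -mulr_natl.
lra.
Qed.

(** Pads the set of rows without an edge to exactly [m] rows, so that averaging over the padded set
    divides by [m] itself. *)
Lemma exists_superset_card A (m : nat) : (#|A| <= m <= #|I|)%N ->
  exists B, A \subset B /\ #|B| = m.
Proof.
move=> /andP[]; move: {2}(m - #|A|)%N (erefl (m - #|A|)%N) => k.
elim: k A => [|k IH] A km Am mI.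
  exists A; split=> //; apply/eqP; rewrite eqn_leq Am/=.
  by rewrite -subn_eq0 km.
have Altm : (#|A| < m)%N by rewrite -subn_gt0 km.
have : (0 < #|~: A|)%N.
  by rewrite cardsCs setCK subn_gt0 (leq_trans Altm).
move=> /card_gt0P[x]; rewrite inE => xA.
have cA : #|x |: A| = #|A|.+1 by rewrite cardsU1 xA.
have [|||B [AB Bm]] := IH (x |: A); rewrite ?cA//.
  by rewrite subnS km.
by exists B; split=> //; apply: subset_trans AB; exact: subsetUr.
Qed.

(** Since [s] is injective, the terms [f i (s j)] are distinct entries of the matrix, and each entry
    is at least minus its absolute value. *)
Lemma sum_abs_le f s A :
  - (\sum_i \sum_j `|f i j|) <= \sum_(i in A) \sum_(j in A) f i (s j).
Proof.
rewrite -sumrN; under eq_bigr do rewrite -sumrN.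
apply: (@le_trans _ _ (\sum_(i in A) \sum_j - `|f i j|)).
  rewrite [leLHS](bigID (mem A))/= gerDl sumr_le0// => i _.
  by rewrite sumr_le0// => j _; rewrite oppr_le0.
apply: ler_sum => i _; rewrite (reindex_inj (@perm_inj _ s))/=.
rewrite [leLHS](bigID (mem A))/=.
apply: (@le_trans _ _ (\sum_(j in A) - `|f i (s j)|)).
  by rewrite gerDl sumr_le0// => j _; rewrite oppr_le0.
by apply: ler_sum => j _; rewrite lerNl; rewrite -normrN ler_norm.
Qed.

(** Fallback for the exceptional event on which some large block stays below the level. Averaging
    over all rows gives the factor [#|I|^-1]; it is weakened to [m^-1] to match the error term of
    [exists_perm_large]. *)
Lemma exists_perm_ge_N f (m : nat) : (0 < m <= #|I|)%N ->
  exists s, - (m%:R^-1 * \sum_i \sum_j `|f i j|) <= \sum_i f i (s i).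
Proof.
move=> /andP[m0 mI].
have [s [_]] := exists_perm_average f 1%g [set: I].
move=> /(le_trans (sum_abs_le f s _)); rewrite cardsT => h.
exists s; have I0 : 0 < #|I|%:R :> R by rewrite ltr0n (leq_trans m0).
have m0R : 0 < m%:R :> R by rewrite ltr0n.
have S0 : 0 <= \sum_i \sum_j `|f i j|.
  by apply: sumr_ge0 => i _; apply: sumr_ge0.
have -> : \sum_i f i (s i) = \sum_(i in [set: I]) f i (s i).
  by apply: eq_bigl => i; rewrite inE.
apply: (@le_trans _ _ (- (#|I|%:R^-1 * \sum_i \sum_j `|f i j|))).
  by rewrite lerN2 ler_wpM2r// lef_pV2 ?posrE// ler_nat.
by rewrite -mulrN ler_pdivrMl.
Qed.

Lemma exists_perm_large f (b : R) (m : nat) : (0 < m <= #|I|)%N ->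
  (forall A B, (m <= #|A|)%N -> (m <= #|B|)%N ->
     exists i j, [/\ i \in A, j \in B & b <= f i j]) ->
  exists s, (#|I| - m)%:R * b - m%:R^-1 * (\sum_i \sum_j `|f i j|) <=
            \sum_i f i (s i).
Proof.
move=> /andP[m0 mI] noempty.
have [s0 hs0] := exists_perm_no_edge (fun i j => b <= f i j).
pose A := [set i | ~~ (b <= f i (s0 i))].
(* More than [m] rows without an edge, together with their images under [s0], would form a block
   contradicting [noempty]. *)
have Am : (#|A| <= m)%N.
  rewrite leqNgt; apply/negP => mA.
  have [|| i [k [iA /imsetP[j jA ->]]]] := noempty A (s0 @: A).
  - exact: ltnW.
  - by rewrite card_imset; [exact: ltnW|exact: perm_inj].
  apply/negP; apply: hs0; first by move: iA; rewrite inE.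
  by move: jA; rewrite inE.
have [|B [AB Bm]] := @exists_superset_card A m; first by rewrite Am.
have [s [sB]] := exists_perm_average f s0 B.
move=> /(le_trans (sum_abs_le f s _)); rewrite Bm => h.
have m0R : 0 < m%:R :> R by rewrite ltr0n.
exists s; rewrite [leRHS](bigID (mem B))/= addrC; apply: lerD; last first.
  by rewrite -mulrN ler_pdivrMl.
have -> : (#|I| - m)%:R * b = \sum_(i | i \notin B) b.
  rewrite sumr_const mulr_natl; congr (_ *+ _).
  by rewrite -Bm -(cardsC B) addKn; apply: eq_card => i; rewrite !inE.
(* A row outside [B] keeps its image under [s0]; being outside [A] as well, its entry reaches
   [b]. *)
apply: ler_sum => i iB; rewrite sB//.
by have := contraNN (fun h => subsetP AB i h) iB; rewrite inE negbK.
Qed.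

End Assignment.

From mathcomp Require Import all_classical all_reals all_analysis.
From mathcomp Require Import measurable_realfun.
Import numFieldNormedType.Exports.
Local Open Scope classical_set_scope.
Local Open Scope ring_scope.

(** * Tail quantiles *)

Section TailQuantile.
Context {R : realType} (P : probability (measurableTypeR R) R).
Local Notation g := (tail_quantile P).

(* [inf] is [0] on sets without an infimum. *)
Lemma tail_quantile_has_inf (p : R) : 0 < g p ->
  has_inf [set r : R | (P (`[r, +oo[%classic) <= p%:E)%E].
Proof.
by move=> gp; apply: contrapT => /inf_out E; move: gp; rewrite /tail_quantile E ltxx.
Qed.

Lemma tail_quantile_gt (p r : R) : 0 < g p -> g p < r ->
  (P (`[r, +oo[%classic) <= p%:E)%E.
Proof.
move=> /tail_quantile_has_inf hi gr.
have rg : 0 < r - g p by rewrite subr_gt0.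
have [x /= Px xr] := inf_adherent rg hi.
apply: le_trans Px; apply: le_measure; rewrite ?inE//.
move=> y /=; rewrite !in_itv/= !andbT => ry.
by rewrite (le_trans _ ry)// ltW// (lt_le_trans xr)// /tail_quantile addrC subrK.
Qed.

Lemma tail_quantile_lt (p r : R) : 0 < g p -> r < g p ->
  (p%:E <= P (`[r, +oo[%classic))%E.
Proof.
move=> /tail_quantile_has_inf[_ lb] rg; rewrite leNgt; apply/negP => Pr.
have /(ge_inf lb) : [set r : R | (P (`[r, +oo[%classic) <= p%:E)%E] r by exact: ltW.
by rewrite leNgt rg.
Qed.

(** Continuity from below: the open ray is the increasing union of the closed rays from
    [g p + 1/(k+1)], each of probability at most [p]. *)
Lemma tail_quantile_P_gt (p : R) : 0 < g p ->
  (P (`]g p, +oo[%classic) <= p%:E)%E.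
Proof.
move=> gp; pose F n := `[g p + n.+1%:R^-1, +oo[%classic : set (measurableTypeR R).
have FE : `]g p, +oo[%classic = \bigcup_n F n.
  apply/seteqP; split => x; rewrite /F/= in_itv/= andbT.
    move=> gx; have /ltr_add_invr[k gk] := gx.
    by exists k => //=; rewrite in_itv/= andbT ltW.
  move=> [k _]; rewrite /= in_itv/= andbT; apply: lt_le_trans.
  by rewrite ltrDl.
have mF n : measurable (F n) by exact: measurable_itv.
have : (P \o F) x @[x --> \oo] --> P (\bigcup_n F n).
  apply: nondecreasing_cvg_mu => //; first exact: bigcup_measurable.
  move=> n m nm; rewrite subsetEset => x; rewrite /F/= !in_itv/= !andbT.
  by apply: le_trans; rewrite lerD2l lef_pV2 ?posrE// ler_nat.
rewrite FE => /cvg_lim <-//; apply: lime_le.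
  apply: ereal_nondecreasing_is_cvgn => n m nm.
  apply: le_measure; rewrite ?inE//.
  move=> x; rewrite /F/= !in_itv/= !andbT.
  by apply: le_trans; rewrite lerD2l lef_pV2 ?posrE// ler_nat.
by near=> n; apply: tail_quantile_gt; rewrite ?ltrDl.
Unshelve. all: by end_near. Qed.

(** Continuity from above: the closed ray is the decreasing intersection of the rays from
    [g p - 1/(k+1)], each of probability at least [p]. *)
Lemma tail_quantile_P_ge (p : R) : 0 < g p ->
  (p%:E <= P (`[g p, +oo[%classic))%E.
Proof.
move=> gp; pose F n := `[g p - n.+1%:R^-1, +oo[%classic : set (measurableTypeR R).
have FE : `[g p, +oo[%classic = \bigcap_n F n.
  apply/seteqP; split => x; rewrite /F/= in_itv/= andbT.
    move=> gx k _ /=; rewrite in_itv/= andbT.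
    by rewrite (le_trans _ gx)// gerDl oppr_le0.
  move=> Fx; rewrite leNgt; apply/negP => /ltr_add_invr[k xk].
  have := Fx k I; rewrite /= in_itv/= andbT lerBlDr.
  by rewrite leNgt xk.
have mF n : measurable (F n) by exact: measurable_itv.
have homF n m : (n <= m)%N -> F m `<=` F n.
  move=> nm x; rewrite /F/= !in_itv/= !andbT.
  by apply: le_trans; rewrite lerD2l lerN2 lef_pV2 ?posrE// ler_nat.
have : (P \o F) x @[x --> \oo] --> P (\bigcap_n F n).
  apply: nonincreasing_cvg_mu => //.
  - by rewrite (le_lt_trans (probability_le1 _ _))// ltry.
  - exact: bigcap_measurable.
  - by move=> n m nm; rewrite subsetEset; exact: homF.
rewrite FE => /cvg_lim <-//; apply: lime_ge.
  apply: ereal_nonincreasing_is_cvgn => n m nm.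
  by apply: le_measure; rewrite ?inE//; exact: homF.
by near=> n; apply: tail_quantile_lt => //; rewrite gtrDl oppr_lt0.
Unshelve. all: by end_near. Qed.

Lemma le_tail_quantile (p q : R) : 0 < g p -> 0 < g q -> p <= q -> g q <= g p.
Proof.
move=> /tail_quantile_has_inf[p0 plb] /tail_quantile_has_inf[q0 qlb] pq.
apply: lb_le_inf => // r /= Pr; apply: ge_inf => //=.
by rewrite (le_trans Pr)// lee_fin.
Qed.

End TailQuantile.

(** * Means of real functions *)

Section Mean.
Context {d : measure_display} {T : measurableType d} {R : realType}.
Variable Pr : probability T R.
Implicit Types (f h : T -> R) (c : R).

(** Couples integrability with a real value of the integral, so that means can be added and scaled
    as real numbers. *)
Definition has_mean f c :=
  Pr.-integrable setT (EFin \o f) /\ (\int[Pr]_t (f t)%:E = c%:E)%E.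

Lemma has_mean_eq {f h c} : has_mean f c -> f =1 h -> has_mean h c.
Proof. by move=> fc /funext <-. Qed.

Lemma has_meanD {f h c c'} : has_mean f c -> has_mean h c' ->
  has_mean (fun t => f t + h t) (c + c').
Proof.
move=> [fi fE] [hi hE]; split.
  exact: (integrableD measurableT fi hi).
by rewrite EFinD -fE -hE -integralD_EFin.
Qed.

Lemma has_meanZ k {f c} : has_mean f c -> has_mean (fun t => k * f t) (k * c).
Proof.
move=> [fi fE]; split; first exact: (integrableZl measurableT k fi).
by rewrite EFinM -fE -integralZl.
Qed.

Lemma has_mean_cst k : has_mean (fun=> k) k.
Proof.
split; first exact: finite_measure_integrable_cst.
rewrite integral_cst//. by rewrite [X in (_ * X)%E](@probability_setT _ _ _ Pr) mule1.
Qed.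

Lemma has_mean_sum (I : Type) (r : seq I) (Q : pred I) {F : I -> T -> R} {C : I -> R} :
  (forall i, has_mean (F i) (C i)) ->
  has_mean (fun t => \sum_(i <- r | Q i) F i t) (\sum_(i <- r | Q i) C i).
Proof.
move=> FC; elim: r => [|i r IH].
  rewrite big_nil. refine (has_mean_eq (has_mean_cst 0) _) => t.
  by rewrite big_nil.
rewrite big_cons; case: ifPn => Qi.
  refine (has_mean_eq (has_meanD (FC i) IH) _) => t.
  by rewrite big_cons Qi.
by refine (has_mean_eq IH _) => t; rewrite big_cons (negbTE Qi).
Qed.

Lemma has_mean_indic {A : set T} {c} : measurable A -> Pr A = c%:E ->
  has_mean \1_A c.
Proof.
move=> mA PA.
have E : (\int[Pr]_t (\1_A t)%:E = c%:E)%E by rewrite integral_indic// setIT.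
split=> //; apply/integrableP; split.
  by apply/measurable_EFinP; exact: measurable_indic.
under eq_integral do rewrite /= ger0_norm//.
by rewrite E ltry.
Qed.

(** The maxima are extended-real valued; domination by [|u| + |v|] makes [M] integrable, and
    monotonicity of the integral then applies. *)
Lemma mean_squeeze {M : T -> \bar R} {u v cu cv} : measurable_fun setT M ->
  has_mean u cu -> has_mean v cv ->
  (forall t, ((u t)%:E <= M t <= (v t)%:E)%E) ->
  (cu%:E <= \int[Pr]_t M t <= cv%:E)%E.
Proof.
move=> mM [ui uE] [vi vE] uMv.
have Mi : Pr.-integrable setT M.
  apply: (@le_integrable _ _ _ Pr setT _ M (fun t => `|(u t)%:E| + `|(v t)%:E|)%E) => //.
    move=> t _; have /andP[uM Mv] := uMv t.
    rewrite [leRHS]gee0_abs; last by rewrite adde_ge0.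
    case: (M t) uM Mv => [r| |]//=; rewrite !lee_fin ler_norml => ur rv.
    have := ler_norm (v t); have := ler_norm (- u t); rewrite normrN.
    by have := normr_ge0 (v t); have := normr_ge0 (u t); lra.
  by apply: integrableD => //; exact: integrable_abse.
rewrite -uE -vE; apply/andP; split; apply: le_integral => // t _;
  by have /andP[] := uMv t.
Qed.

Lemma measurable_bigmaxe (I : Type) (r : seq I) (F : I -> T -> R) :
  (forall i, measurable_fun setT (F i)) ->
  measurable_fun setT (fun t => \big[Order.max/-oo%E]_(i <- r) (F i t)%:E).
Proof.
move=> mF; elim: r => [|i r IH].
  by under eq_fun do rewrite big_nil; exact: measurable_cst.
under eq_fun do rewrite big_cons.
by apply: measurable_maxe => //; apply/measurable_EFinP.
Qed.

End Mean.

(** * Independent variables with a common law *)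

Section Iid.
Context {d : measure_display} {T : measurableType d} {R : realType}.
Context {Pr : probability T R} {I : finType} {X : I -> T -> R}.
Context {P : probability (measurableTypeR R) R}.
Hypothesis iidX : iid_with_law Pr X P.

Lemma iid_measurable i : measurable_fun setT (X i).
Proof. by case: iidX. Qed.

(** Change of variables: the image of [Pr] under [X i] is [P], and for nonnegative [f] the formula
    is available before integrability is known. *)
Lemma iid_has_mean {f : R -> R} {c} i : (forall x, 0 <= f x) ->
  has_mean P f c -> has_mean Pr (fun t => f (X i t)) c.
Proof.
move=> f0 [fi fE].
have mf : measurable_fun setT f by move/measurable_int : fi => /measurable_EFinP.
have E : (\int[Pr]_t (f (X i t))%:E = \int[P]_x (f x)%:E)%E.
  have := @ge0_integral_pushforward _ _ _ (measurableTypeR R) R (X i) (iid_measurable i) Pr setT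
    (EFin \o f) measurableT.
  rewrite preimage_setT => <-//; last first.
  - by move=> y _ /=; rewrite lee_fin.
  - exact: (measurable_int _ fi).
  apply: eq_measure_integral => [|? A mA _]; first exact: iid_measurable.
  by have [_ [law _]] := iidX; exact: (law i A mA).
split; last by rewrite E.
apply/integrableP; split.
  by apply/measurable_EFinP; apply: measurableT_comp => //; exact: iid_measurable.
under eq_integral do rewrite /= ger0_norm//.
by rewrite E fE ltry.
Qed.

(** Independence turns the probability into a power of [P (X < b) <= 1 - p], and
    [1 - p <= expR (- p)]. *)
Lemma iid_all_lt (J : {set I}) (b p : R) : (p%:E <= P (`[b, +oo[%classic))%E ->
  exists2 c, Pr (\bigcap_(i in [set i | i \in J]) (X i @^-1` `]-oo, b[%classic)) = c%:E &
    c <= expR (- (p * #|J|%:R)).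
Proof.
move=> pb; have [_ [law ind]] := iidX.
have mI : measurable (`]-oo, b[%classic : set R) by exact: measurable_itv.
have -> := ind J (fun=> `]-oo, b[%classic) (fun=> mI).
under eq_bigr do rewrite law//.
have fP : P `]-oo, b[%classic \is a fin_num by exact: fin_num_measure.
have PC : (P (`]-oo, b[%classic : set R) <= (1 - p)%:E)%E.
  have -> : `]-oo, b[%classic = ~` `[b, +oo[%classic :> set R by rewrite setCitvr.
  by rewrite probability_setC ?EFinB ?leeB.
rewrite -(fineK fP) prodEFin; eexists; first reflexivity.
rewrite prodr_const -mulNr mulrC expRM_natl.
apply: lerXn2r; rewrite ?nnegrE ?expR_ge0 ?fine_ge0//.
rewrite -lee_fin fineK//; apply: (le_trans PC); rewrite lee_fin.
exact: expR_ge1Dx.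
Qed.

End Iid.

(** * Slow variation *)

(** Chooses the working tolerance of the later estimates: [4 * t] absorbs the accumulated errors,
    and [t <= 1/2] keeps [1 - t] positive and [(1 + t) / 2] at most [3/4]. *)
Lemma exists_small {R : realFieldType} (e : R) : 0 < e ->
  exists t, [/\ 0 < t, 4 * t <= e & t <= 2^-1].
Proof.
move=> e0; exists (Num.min (e / 4) 2^-1); rewrite lt_min ge_min lexx orbT.
split=> //; first by apply/andP; split; lra.
have : Num.min (e / 4) 2^-1 <= e / 4 by rewrite ge_min lexx.
lra.
Qed.

Lemma near_right0P {R : realType} (Q : set R) : (\forall p \near 0^'+, Q p) ->
  exists2 p0 : R, 0 < p0 & forall p, 0 < p -> p < p0 -> Q p.
Proof.
move=> [p0 /= p00 H]; exists p0 => // p p1 p2; apply: H => //=.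
by rewrite sub0r normrN gtr0_norm.
Qed.

Lemma ge0_has_mean {d : measure_display} {T : measurableType d} {R : realType}
    (Pr : probability T R) (f : T -> R) (c : R) : measurable_fun setT f ->
  (forall t, 0 <= f t) -> (\int[Pr]_t (f t)%:E <= c%:E)%E ->
  exists2 c', has_mean Pr f c' & c' <= c.
Proof.
move=> mf f0 fc.
have fin : (\int[Pr]_t (f t)%:E)%E \is a fin_num.
  rewrite ge0_fin_numE; first by rewrite (le_lt_trans fc) ?ltry.
  by apply: integral_ge0 => t _; rewrite lee_fin.
exists (fine (\int[Pr]_t (f t)%:E)%E); last by rewrite -lee_fin fineK.
split; last by rewrite fineK.
apply/integrableP; split; first exact/measurable_EFinP.
under eq_integral do rewrite /= ger0_norm//.
by rewrite (le_lt_trans fc) ?ltry.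
Qed.

Section SlowVariation.
Context {R : realType} (P : probability (measurableTypeR R) R).
Local Notation g := (tail_quantile P).
Hypothesis g_pinfty : g p @[p --> 0^'+] --> +oo.
Hypothesis g_slow : forall lam : R, 0 < lam ->
  (g (lam * p) / g p) @[p --> 0^'+] --> (1:R).

Lemma tail_quantile_gt_near (A : R) :
  exists2 p0 : R, 0 < p0 & forall p, 0 < p -> p < p0 -> A < g p.
Proof. by apply: near_right0P; move/cvgryPgt : g_pinfty; apply. Qed.

Lemma tail_quantile_slow_near (lam e : R) : 0 < lam -> 0 < e ->
  exists2 p0 : R, 0 < p0 & forall p, 0 < p -> p < p0 ->
    [/\ 0 < g p, (1 - e) * g p <= g (lam * p) & g (lam * p) <= (1 + e) * g p].
Proof.
move=> lam0 e0; have [p1 p10 g1] := tail_quantile_gt_near 0.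
have [|p2 p20 g2] := @near_right0P _ [set p | `|1 - g (lam * p) / g p| < e].
  by move/cvgrPdist_lt : (g_slow lam lam0); apply.
exists (Num.min p1 p2); first by rewrite lt_min p10.
move=> p p0; rewrite lt_min => /andP[pp1 pp2].
have gp := g1 _ p0 pp1; have := g2 _ p0 pp2; rewrite /= ltr_norml => /andP[h1 h2].
split=> //.
  by rewrite -ler_pdivlMr//; lra.
by rewrite -ler_pdivrMr//; lra.
Qed.

Lemma sum_expr_34 n : \sum_(k < n) (3 / 4 : R) ^+ k <= 4.
Proof.
have -> : \sum_(k < n) (3 / 4 : R) ^+ k = 4 - 4 * (3 / 4) ^+ n.
  elim: n => [|n IH]; first by rewrite big_ord0 expr0; lra.
  by rewrite big_ord_recr/= IH exprS; lra.
by rewrite lerBlDr lerDl mulr_ge0// exprn_ge0//; lra.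
Qed.

(* The layers are cut at the quantiles [g (p / 2^k)]: the k-th layer has
   probability at most [p / 2^k] and height at most [e (1 + e)^k g p]. *)
Lemma mean_excess_small (eps : R) : 0 < eps ->
  exists2 p0 : R, 0 < p0 & forall p, 0 < p -> p < p0 ->
    0 < g p /\ exists2 c, has_mean P (fun x => Num.max (x - g p) 0) c &
      c <= eps * p * g p.
Proof.
move=> /exists_small[e [e0 e4 e2]].
have h0 : 0 < 2^-1 :> R by rewrite invr_gt0.
have [p0 p00 hp0] := tail_quantile_slow_near 2^-1 e h0 e0.
exists p0 => // p pgt0 pp0.
have [gp _ _] := hp0 _ pgt0 pp0; split=> //.
pose q k := p * 2^-1 ^+ k; pose a k := g (q k).
have a0E : a 0%N = g p by rewrite /a /q expr0 mulr1.
have q0 k : 0 < q k by rewrite mulr_gt0// exprn_gt0.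
have qp k : q k < p0.
  rewrite (le_lt_trans _ pp0)// ger_pMr// exprn_ile1//; lra.
have agt0 k : 0 < a k by have [] := hp0 _ (q0 k) (qp k).
have qS k : q k.+1 = 2^-1 * q k by rewrite /q exprS mulrCA.
have aS k : a k <= a k.+1.
  apply: (le_tail_quantile P _ _ (agt0 _) (agt0 _)); rewrite qS ger_pMl//; lra.
have aSe k : a k.+1 <= (1 + e) * a k.
  by rewrite /a qS; have [] := hp0 _ (q0 k) (qp k).
have aX k : a k <= (1 + e) ^+ k * g p.
  elim: k => [|k IH]; first by rewrite a0E expr0 mul1r.
  by rewrite exprS -mulrA (le_trans (aSe k))// ler_pM2l//; lra.
(* A layer is counted in full as soon as [x] exceeds its bottom [a k]. This overestimates the
   excess, but its mean involves only the tail at [a k]. *)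
pose f k x : \bar R := ((a k.+1 - a k) * \1_(`]a k, +oo[%classic : set R) x)%:E.
have f0 k x : (0 <= f k x)%E by rewrite lee_fin mulr_ge0// subr_ge0.
have mf k : measurable_fun setT (f k).
  apply/measurable_EFinP; apply: measurable_funM; first exact: measurable_cst.
  by apply: measurable_indic; exact: measurable_itv.
have fE k : (\int[P]_x f k x <= (e * g p * p * (3 / 4) ^+ k)%:E)%E.
  have mA : measurable (`]a k, +oo[%classic : set (measurableTypeR R)).
    exact: measurable_itv.
  have PA : P (`]a k, +oo[%classic : set R) = (fine (P `]a k, +oo[%classic))%:E.
    by rewrite fineK// fin_num_measure.
  have [_ ->] := has_meanZ P (a k.+1 - a k) (has_mean_indic P mA PA).
  rewrite lee_fin.
  have : fine (P `]a k, +oo[%classic) <= q k.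
    by rewrite -lee_fin -PA; exact: (tail_quantile_P_gt P (q k) (agt0 k)).
  have : a k.+1 - a k <= e * ((1 + e) ^+ k * g p).
    have := aSe k; have : e * a k <= e * ((1 + e) ^+ k * g p) by rewrite ler_pM2l.
    lra.
  move=> h1 h2; apply: (@le_trans _ _ (e * ((1 + e) ^+ k * g p) * q k)).
    by apply: ler_pM => //; [rewrite subr_ge0|rewrite fine_ge0].
  (* From one layer to the next the probability bound halves while the height bound grows by
     [1 + e], hence a geometric ratio of at most [3/4]. *)
  have -> : e * ((1 + e) ^+ k * g p) * q k = e * g p * p * ((1 + e) / 2) ^+ k.
    by rewrite /q exprMn; ring.
  rewrite ler_pM2l ?mulr_gt0//; apply: lerXn2r; rewrite ?nnegrE; lra.
(* The levels are unbounded because [q k] tends to 0 and [g] tends to infinity there. *)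
have aoo x : exists k, x <= a k.
  have [q1 q10 hq1] := tail_quantile_gt_near x.
  have : geometric p 2^-1 n @[n --> \oo] --> 0.
    by apply: cvg_geometric; rewrite ger0_norm; lra.
  move=> /cvgrPdist_lt/(_ _ q10)[N _ /(_ N (leqnn _))] /=.
  rewrite sub0r normrN gtr0_norm ?q0// => qN.
  by exists N; rewrite ltW// hq1 ?q0.
have pointwise x : ((Num.max (x - g p) 0)%:E <= \sum_(k <oo) f k x)%E.
  have [|xa] := leP (x - g p) 0.
    by move=> _; apply: nneseries_ge0.
  have [K xK] := aoo x.
  apply: (@le_trans _ _ (\sum_(0 <= k < K) f k x)%E); last first.
    exact: nneseries_lim_ge.
  rewrite /f sumEFin lee_fin.
  (* Truncating [x] at [a n] gives an induction: below [a n] the left side stops growing, above it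
     the new layer covers the increment. *)
  suff H n : Num.min x (a n) - g p <=
      \sum_(0 <= k < n) (a k.+1 - a k) * \1_(`]a k, +oo[%classic : set R) x.
    by have := H K; rewrite min_l.
  elim: n => [|n IH].
    by rewrite big_geq// a0E subr_le0 ge_min lexx orbT.
  rewrite big_nat_recr//=.
  have := aS n; move: IH.
  rewrite [in X in _ -> _ -> X]indicE mem_setE in_itv/= andbT.
  have [xn|xn] := ltP (a n) x.
    move=> IH an; have : Num.min x (a n.+1) <= a n.+1 by rewrite ge_min lexx orbT.
    by rewrite /=; lra.
  move=> IH an; rewrite min_l ?(le_trans xn)//=; lra.
have mexc : measurable_fun setT (fun x : R => Num.max (x - g p) 0).
  apply: measurable_maxr; last exact: measurable_cst.
  by apply: measurable_funB; [exact: measurable_id|exact: measurable_cst].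
apply: (ge0_has_mean P).
- exact: mexc.
- by move=> x; rewrite le_max lexx orbT.
apply: (@le_trans _ _ (\int[P]_x \sum_(k <oo) f k x)%E).
  apply: ge0_le_integral => //.
  - by move=> x _; rewrite lee_fin le_max lexx orbT.
  - exact/measurable_EFinP.
  - by apply: ge0_emeasurable_sum => [k x _ _|k _]; [exact: f0|exact: mf].
rewrite integral_nneseries//.
apply: lime_le.
  by apply: is_cvg_nneseries => k _ _; apply: integral_ge0.
near=> n.
apply: (@le_trans _ _ (\sum_(0 <= k < n) (e * g p * p * (3 / 4) ^+ k)%:E)%E).
  by apply: lee_sum.
rewrite sumEFin lee_fin -mulr_sumr big_mkord.
apply: (@le_trans _ _ (e * g p * p * 4)).
  by rewrite ler_pM2l ?sum_expr_34 ?mulr_gt0.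
have -> : e * g p * p * 4 = 4 * e * (p * g p) by ring.
by rewrite -[eps * p * _]mulrA ler_pM2r ?mulr_gt0.
Unshelve. all: by end_near. Qed.

End SlowVariation.

Lemma asymptotic_of_bounds {R : realType} (F : nat -> \bar R) (G : nat -> R) :
  (forall e : R, 0 < e -> \forall n \near \oo,
     0 < G n /\ (((1 - e) * G n)%:E <= F n <= ((1 + e) * G n)%:E)%E) ->
  exists e : nat -> R, e @ \oo --> (0:R) /\
    \forall n \near \oo, F n = (G n * (1 + e n))%:E.
Proof.
move=> FG; exists (fun n => fine (F n) / G n - 1); split.
  apply/cvgrPdist_le => e e0; apply: filterS (FG e e0) => n [Gn].
  case: (F n) => [r| |]; rewrite ?leye_eq ?leeNy_eq ?andbF//= ?lee_fin => /andP[].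
  rewrite -ler_pdivlMr// => h1; rewrite -ler_pdivrMr// => h2.
  rewrite sub0r normrN ler_norml; apply/andP; split; lra.
(* Any one tolerance suffices here: the bounds make [F n] finite, so [fine] loses nothing. *)
apply: filterS (FG 1 ltr01) => n [Gn].
case: (F n) => [r| |]; rewrite ?leye_eq ?leeNy_eq ?andbF//= => _.
by rewrite subrKC mulrC divfK// gt_eqF.
Qed.

(** * Bounds for a fixed size *)

Section FixedSize.
Context {d : measure_display} {T : measurableType d} {R : realType}.
Context {Pr : probability T R} {P : probability (measurableTypeR R) R}.
(** Level [a] serves the upper bounds and [b] the lower ones; later [a = g (1/n)], [b = g (L/n)] and
    [p = L/n]. *)
Variables (a b p c m1 : R).
Hypothesis b0 : 0 <= b.
Hypothesis p_tail : (p%:E <= P (`[b, +oo[%classic))%E.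
Hypothesis c_mean : has_mean P (fun x => Num.max (x - a) 0) c.
Hypothesis m1_mean : has_mean P (fun x => `|x|) m1.

Let excess_ge0 (x : R) : 0 <= Num.max (x - a) 0.
Proof. by rewrite le_max lexx orbT. Qed.

Let le_excess (x : R) : x <= a + Num.max (x - a) 0.
Proof. by rewrite -lerBlDl le_max lexx. Qed.

Lemma measurable_all_lt {I : finType} {X : I -> T -> R} (J : {set I}) :
  iid_with_law Pr X P ->
  measurable (\bigcap_(i in [set i | i \in J]) (X i @^-1` `]-oo, b[%classic)).
Proof.
move=> hX; apply: fin_bigcap_measurable => [|i _].
  exact: finite_finset.
rewrite -[X in measurable X]setTI.
by apply: (iid_measurable hX i) => //; exact: measurable_itv.
Qed.

Lemma mean_max_bounds {n : nat} {X : 'I_n -> T -> R} : iid_with_law Pr X P ->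
  (0 < n)%N ->
  ((b * (1 - expR (- (p * n%:R))) - m1)%:E <=
     \int[Pr]_t (\big[Order.max/-oo]_(i < n) (X i t)%:E) <=
   (a + n%:R * c)%:E)%E.
Proof.
move=> hX n0; pose i0 := Ordinal n0.
pose E := \bigcap_(i in [set i | i \in [set: 'I_n]%SET]) (X i @^-1` `]-oo, b[%classic).
have mE : measurable E by exact: measurable_all_lt.
have [q Eq qle] := iid_all_lt hX [set: 'I_n]%SET b p p_tail.
(* The minorant is [b * (1 - \1_E) - |X i0|]: off [E] some variable reaches [b], and on [E] the
   maximum is still at least [X i0]. *)
have mu := has_meanD Pr (has_meanZ Pr b (has_meanD Pr (has_mean_cst Pr 1)
  (has_meanZ Pr (-1) (has_mean_indic Pr mE Eq))))
  (has_meanZ Pr (-1) (iid_has_mean hX i0 (@normr_ge0 _ _) m1_mean)).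
have mv := has_meanD Pr (has_mean_cst Pr a)
  (has_mean_sum Pr _ (index_enum 'I_n) predT (fun i => iid_has_mean hX i excess_ge0 c_mean)).
have mM : measurable_fun setT (fun t => \big[Order.max/-oo%E]_(i < n) (X i t)%:E).
  by apply: measurable_bigmaxe => i; exact: (iid_measurable hX).
have := mean_squeeze Pr mM mu mv.
case/(_ _)/andP.
  move=> t; apply/andP; split; last first.
    apply: bigmax_le => [|i _]; first exact: leNye.
    rewrite lee_fin (le_trans (le_excess _))// lerD2l.
    rewrite (bigD1 i)//= lerDl sumr_ge0//.
  have Xi i : ((X i t)%:E <= \big[Order.max/-oo%E]_(i < n) (X i t)%:E)%E.
    exact: le_bigmax.
  rewrite !mulN1r indicE; have [tE|tE] := boolP (t \in E).
    rewrite /= subrr mulr0 add0r (le_trans _ (Xi i0))// lee_fin.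
    by rewrite lerNl -normrN ler_norm.
  have [i bi] : exists i, b <= X i t.
    apply/not_existsP => h; move/negP : tE; apply; rewrite inE => i _ /=.
    by rewrite in_itv/= ltNge; apply/negP; exact: h.
  rewrite /= subr0 mulr1 (le_trans _ (Xi i))// lee_fin.
  by rewrite (le_trans _ bi)// gerDl oppr_le0.
move=> lo hi; apply/andP; split.
  apply: le_trans lo; rewrite lee_fin !mulN1r lerD2r ler_wpM2l// lerD2l lerN2.
  by rewrite (le_trans qle)// cardsT card_ord.
by rewrite (le_trans hi)// lee_fin sumr_const card_ord mulr_natl.
Qed.

Lemma mean_assignment_bounds {n m : nat} {Y : ('I_n * 'I_n)%type -> T -> R} :
  iid_with_law Pr Y P -> (0 < m <= n)%N -> 0 <= p ->
  (((n - m)%:R * b * (1 - 4 ^+ n * expR (- (p * (m * m)%:R)))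
      - m%:R^-1 * (n%:R * n%:R * m1))%:E <=
     \int[Pr]_t (\big[Order.max/-oo]_(s : 'S_n) (\sum_(i < n) Y (i, s i) t)%:E) <=
   (n%:R * a + n%:R * n%:R * c)%:E)%E.
Proof.
move=> hY mn p0.
pose E (AB : {set 'I_n} * {set 'I_n}) :=
  \bigcap_(ij in [set ij | ij \in finset.setX AB.1 AB.2]) (Y ij @^-1` `]-oo, b[%classic).
pose Q (AB : {set 'I_n} * {set 'I_n}) := (m <= #|AB.1|)%N && (m <= #|AB.2|)%N.
have mE AB : measurable (E AB) by exact: measurable_all_lt.
have EE AB : Pr (E AB) = (fine (Pr (E AB)))%:E by rewrite fineK// fin_num_measure.
have Ele AB : Q AB -> fine (Pr (E AB)) <= expR (- (p * (m * m)%:R)).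
  move=> /andP[mA mB].
  have [q Eq qle] := iid_all_lt hY (finset.setX AB.1 AB.2) b p p_tail.
  rewrite /E Eq/= (le_trans qle)// ler_expR lerN2 ler_wpM2l// ler_nat cardsX.
  exact: leq_mul.
(* The minorant multiplies [(n - m) * b] by 1 minus the number of blocks below [b]. One such block
   makes this term nonpositive, so the crude bound [exists_perm_ge_N] is enough there. *)
have mu := has_meanD Pr (has_meanZ Pr ((n - m)%:R * b) (has_meanD Pr (has_mean_cst Pr 1)
  (has_meanZ Pr (-1) (has_mean_sum Pr _ (index_enum _) Q
     (fun AB => has_mean_indic Pr (mE AB) (EE AB))))))
  (has_meanZ Pr (- m%:R^-1) (has_mean_sum Pr _ (index_enum 'I_n) predT (fun i =>
     has_mean_sum Pr _ (index_enum 'I_n) predT (fun j =>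
       iid_has_mean hY (i, j) (@normr_ge0 _ _) m1_mean)))).
have mv := has_meanD Pr (has_mean_cst Pr (n%:R * a))
  (has_mean_sum Pr _ (index_enum 'I_n) predT (fun i =>
     has_mean_sum Pr _ (index_enum 'I_n) predT (fun j =>
       iid_has_mean hY (i, j) excess_ge0 c_mean))).
have mM : measurable_fun setT
    (fun t => \big[Order.max/-oo%E]_(s : 'S_n) (\sum_(i < n) Y (i, s i) t)%:E).
  apply: measurable_bigmaxe => s; apply: measurable_sum => i.
  exact: (iid_measurable hY).
have := mean_squeeze Pr mM mu mv.
case/(_ _)/andP.
  move=> t; apply/andP; split; last first.
    apply: bigmax_le => [|s _]; first exact: leNye.
    rewrite lee_fin mulr_natl -[X in a *+ X]card_ord -sumr_const -big_split/=.
    apply: ler_sum => i _; rewrite (le_trans (le_excess _))// lerD2l.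
    by rewrite [leRHS](bigD1 (s i))//= lerDl sumr_ge0.
  set M := \big[Order.max/-oo%E]_(s : 'S_n) _.
  have Ms (s : 'S_n) : ((\sum_(i < n) Y (i, s i) t)%:E <= M)%E by exact: le_bigmax.
  set S := \sum_(AB | Q AB) _.
  have S0 : 0 <= S by apply: sumr_ge0.
  have nmb : 0 <= (n - m)%:R * b by rewrite mulr_ge0.
  rewrite !mulN1r mulNr.
  have mI : (0 < m <= #|'I_n|)%N by rewrite card_ord.
  have [[AB QAB EAB]|noE] := pselect (exists2 AB, Q AB & E AB t).
    have S1 : 1 <= S.
      rewrite /S (bigD1 AB)//= indicE mem_set//= lerDl.
      exact: sumr_ge0.
    have [s hs] := exists_perm_ge_N (fun i j => Y (i, j) t) m mI.
    rewrite (le_trans _ (Ms s))// lee_fin (le_trans _ hs)// gerDr.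
    by rewrite mulr_ge0_le0// subr_le0.
  have [|s hs] := exists_perm_large (fun i j => Y (i, j) t) b m mI.
    move=> A B mA mB; apply: contrapT => h; apply: noE.
    exists (A, B); first by rewrite /Q mA.
    move=> [i j] /=; rewrite finset.in_setX => /andP[iA jB].
    rewrite in_itv/= ltNge; apply/negP => bY; apply: h.
    by exists i, j.
  rewrite (le_trans _ (Ms s))// lee_fin (le_trans _ hs)// card_ord lerD2r.
  by rewrite -[leRHS]mulr1 ler_wpM2l// gerDl oppr_le0.
move=> lo hi; apply/andP; split.
  apply: le_trans lo; rewrite lee_fin !mulN1r !mulNr; apply: lerD.
    rewrite ler_wpM2l ?mulr_ge0// lerD2l lerN2.
    apply: (@le_trans _ _ (\sum_(AB | Q AB) expR (- (p * (m * m)%:R)))).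
      exact: ler_sum.
    (* The union bound is extended to all pairs of subsets, of which there are [4 ^ n]. *)
    apply: (@le_trans _ _ (\sum_(AB : {set 'I_n} * {set 'I_n}) expR (- (p * (m * m)%:R)))).
      rewrite [leRHS](bigID Q)/= lerDl; apply: sumr_ge0 => i _; exact: expR_ge0.
    rewrite sumr_const card_prod -[X in X <= _]mulr_natl ler_wpM2r ?expR_ge0//.
    have -> : #|{set 'I_n}| = (2 ^ n)%N.
      by rewrite -finset.cardsT -finset.powersetT finset.card_powerset finset.cardsT card_ord.
    rewrite -natrX ler_nat -expnMn.
    exact: leqnn.
  rewrite lerN2 ler_wpM2l ?invr_ge0//.
  by rewrite !sumr_const card_ord -mulrnA -[leLHS]mulr_natl natrM mulrC.
rewrite (le_trans hi)// lee_fin lerD2l.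
by rewrite !sumr_const card_ord -mulrnA -[leLHS]mulr_natl natrM.
Qed.

End FixedSize.

(** * Asymptotics *)

Lemma near_infty_ltdivn {R : realType} (lam p0 : R) : 0 < p0 ->
  \forall n \near \oo, lam * n%:R^-1 < p0.
Proof.
move=> p00; near=> n.
have n0 : 0 < n%:R :> R by near: n; exact: nbhs_infty_gtr.
rewrite ltr_pdivrMr// -ltr_pdivrMl//.
by near: n; exact: nbhs_infty_gtr.
Unshelve. all: by end_near. Qed.

(** Inverts [1/x <= expR (1/x)]; it turns the choice [L = 1/eta] into a failure probability of at
    most [eta]. *)
Lemma expRN_invr_le {R : realType} (x : R) : 0 < x -> expR (- x^-1) <= x.
Proof.
move=> x0; rewrite expRN -[leRHS]invrK lef_pV2 ?posrE ?invr_gt0 ?expR_gt0//.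
by have := expR_ge1Dx x^-1; lra.
Qed.

Section EventualBounds.
Context {R : realType} (P : probability (measurableTypeR R) R).
Local Notation g := (tail_quantile P).
Hypothesis P_int : (\int[P]_x (`|x|)%:E < +oo)%E.
Hypothesis g_pinfty : g p @[p --> 0^'+] --> +oo.
Hypothesis g_slow : forall lam : R, 0 < lam ->
  (g (lam * p) / g p) @[p --> 0^'+] --> (1:R).

Lemma exists_mean_abs : exists2 m1, has_mean P (fun x => `|x|) m1 & 0 <= m1.
Proof.
have I0 : (0 <= \int[P]_x (`|x|)%:E)%E by apply: integral_ge0 => x _; rewrite lee_fin.
exists (fine (\int[P]_x (`|x|)%:E)%E); last exact: fine_ge0.
split; last by rewrite fineK// ge0_fin_numE.
apply/integrableP; split.
  by apply/measurable_EFinP; exact: normr_measurable.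
by under eq_integral do rewrite /= normr_id.
Qed.

(* The quantile [g (L / n)] is exceeded often enough when [L] is large, and
   slow variation makes it comparable to [g (1 / n)]. *)
Lemma quantile_near (L A eta : R) : 0 < L -> 0 < eta ->
  \forall n \near \oo, let q := n%:R^-1 : R in
    [/\ (0 < n)%N, A < g q /\ 0 < g q,
        (1 - eta) * g q <= g (L * q) /\ 0 < g (L * q) &
        exists2 c, has_mean P (fun x => Num.max (x - g q) 0) c &
          c <= eta * q * g q].
Proof.
move=> L0 eta0.
have [p1 p10 h1] := tail_quantile_gt_near P g_pinfty A.
have [p2 p20 h2] := tail_quantile_slow_near P g_pinfty g_slow L eta L0 eta0.
have [p3 p30 h3] := mean_excess_small P g_pinfty g_slow eta eta0.
have [p4 p40 h4] := tail_quantile_gt_near P g_pinfty 0.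
near=> n; set q := n%:R^-1 : R.
have n0 : (0 < n)%N by near: n; exact: nbhs_infty_gt.
have q0 : 0 < q by rewrite invr_gt0 ltr0n.
have qlt p0 : q < p0 = (1 * n%:R^-1 < p0) by rewrite mul1r.
have q1 : q < p1 by rewrite qlt; near: n; exact: near_infty_ltdivn.
have q2 : q < p2 by rewrite qlt; near: n; exact: near_infty_ltdivn.
have q3 : q < p3 by rewrite qlt; near: n; exact: near_infty_ltdivn.
have q4 : L * n%:R^-1 < p4 by near: n; exact: near_infty_ltdivn.
have [gq lo _] := h2 _ q0 q2; have [_ ex] := h3 _ q0 q3.
split=> //; split=> //; first exact: h1.
by apply: h4 => //; exact: mulr_gt0.
Unshelve. all: by end_near. Qed.

Lemma mean_max_eventual (d1 : nat -> measure_display)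
    (T1 : forall n, measurableType (d1 n))
    (Pr1 : forall n, probability (T1 n) R) (X : forall n, 'I_n -> T1 n -> R)
    (hX : forall n, iid_with_law (Pr1 n) (X n) P) (e : R) : 0 < e ->
  \forall n \near \oo, 0 < g n%:R^-1 /\
    (((1 - e) * g n%:R^-1)%:E <=
       \int[Pr1 n]_t (\big[Order.max/-oo]_(i < n) (X n i t)%:E) <=
     ((1 + e) * g n%:R^-1)%:E)%E.
Proof.
move=> /exists_small[eta [eta0 eta4 eta2]].
have [m1 m1E _] := exists_mean_abs.
have L0 : 0 < eta^-1 by rewrite invr_gt0.
(* [L = 1/eta] controls the failure probability, and the threshold [m1 / eta] makes [m1] at most
   [eta * g (1/n)]. The total is [(1 - eta)^2 - eta >= 1 - 4 * eta]. *)
apply: filterS (quantile_near eta^-1 (m1 / eta) eta L0 eta0) => n /=.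
move=> [n0 [m1g g0] [lo gL0] [c cE cle]]; split=> //.
have nR : 0 < n%:R :> R by rewrite ltr0n.
have := mean_max_bounds (g n%:R^-1) _ _ _ _ (ltW gL0)
  (tail_quantile_P_ge P _ gL0) cE m1E (hX n) n0.
move=> /andP[h1 h2]; apply/andP; split.
  apply: le_trans h1; rewrite lee_fin divfK ?gt_eqF//.
  have E := expRN_invr_le eta eta0.
  have m1le : m1 <= eta * g n%:R^-1 by rewrite mulrC -ler_pdivrMr// ltW.
  have : (1 - eta) * g n%:R^-1 * (1 - eta) <=
         g (eta^-1 / n%:R) * (1 - expR (- eta^-1)).
    by apply: ler_pM => //; [rewrite mulr_ge0// ?ltW//; lra|lra|lra].
  have : (1 - e) * g n%:R^-1 <= (1 - 4 * eta) * g n%:R^-1.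
    by rewrite ler_pM2r//; lra.
  have : 0 <= eta * eta * g n%:R^-1 by rewrite !mulr_ge0// ltW.
  have : 0 <= eta * g n%:R^-1 by rewrite mulr_ge0// ltW.
  move: m1le; lra.
apply: (le_trans h2); rewrite lee_fin mulrDl mul1r lerD2l.
apply: (@le_trans _ _ (eta * g n%:R^-1)); last by rewrite ler_pM2r//; lra.
by rewrite -ler_pdivlMl// mulrA [_ * eta]mulrC.
Qed.

Lemma mean_assignment_eventual (d2 : nat -> measure_display)
    (T2 : forall n, measurableType (d2 n))
    (Pr2 : forall n, probability (T2 n) R)
    (Y : forall n, ('I_n * 'I_n)%type -> T2 n -> R)
    (hY : forall n, iid_with_law (Pr2 n) (Y n) P) (e : R) : 0 < e ->
  \forall n \near \oo, 0 < n%:R * g n%:R^-1 /\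
    (((1 - e) * (n%:R * g n%:R^-1))%:E <=
       \int[Pr2 n]_t (\big[Order.max/-oo]_(s : 'S_n)
         (\sum_(i < n) Y n (i, s i) t)%:E) <=
     ((1 + e) * (n%:R * g n%:R^-1))%:E)%E.
Proof.
move=> /exists_small[eta [eta0 eta4 eta2]].
have [m1 m1E m10] := exists_mean_abs.
(* Blocks will have size about [n / K]; [K >= 2 / eta] keeps this below [eta * n] even after
   rounding up. *)
pose K := (Num.truncn (2 / eta)).+1.
have KR : 0 < K%:R :> R by rewrite ltr0n.
have Keta : 2 <= eta * K%:R by rewrite -ler_pdivrMl// mulrC ltW// truncnS_gt.
(* With [m * K >= n] this gives [(L / n) * m^2 >= n * (4 / eta)], an exponent linear in [n] that
   beats the [4 ^ n] pairs of subsets. *)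
pose L : R := K%:R * K%:R * (eta / 4)^-1.
have L0 : 0 < L by rewrite !mulr_gt0// invr_gt0; lra.
near=> n.
have : let q := n%:R^-1 in
    [/\ (0 < n)%N, K%:R * m1 / eta < g q /\ 0 < g q,
        (1 - eta) * g q <= g (L * q) /\ 0 < g (L * q) &
        exists2 c, has_mean P (fun x => Num.max (x - g q) 0) c &
          c <= eta * q * g q].
  by near: n; exact: quantile_near.
move=> /= [n0 [m1g g0] [lo gL0] [c cE cle]].
have Kn : (K <= n)%N by near: n; exact: nbhs_infty_ge.
have nR : 0 < n%:R :> R by rewrite ltr0n.
split; first exact: mulr_gt0.
(* The successor ensures [n <= m * K]; since [K <= n], also [m * K <= n + K <= 2 * n]. *)
pose m := (n %/ K).+1.
have mK : n%:R <= m%:R * K%:R :> R.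
  by rewrite -natrM ler_nat ltnW// ltn_ceil.
have m2 : m%:R <= eta * n%:R.
  have : (m * K)%:R <= (2 * n)%:R :> R.
    by rewrite ler_nat [(m * K)%N]mulSn mul2n -addnn leq_add// leq_divM.
  rewrite !natrM => mK2.
  rewrite -(ler_pM2r KR) (le_trans mK2)// mulrAC ler_pM2r//.
have mn : (0 < m <= n)%N.
  rewrite /= -(ler_nat R) (le_trans m2)// ger_pMl//; lra.
have p0 : 0 <= L / n%:R by rewrite divr_ge0// ltW.
have := mean_assignment_bounds (g n%:R^-1) _ _ _ _ (ltW gL0)
  (tail_quantile_P_ge P _ gL0) cE m1E (hY n) mn p0.
move=> /andP[h1 h2]; apply/andP; split.
  apply: le_trans h1; rewrite lee_fin.
  have mR : 0 < m%:R :> R by rewrite ltr0n.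
  have S : 4 ^+ n * expR (- (L / n%:R * (m * m)%:R)) <= eta.
    apply: (@le_trans _ _ (4 ^+ n * expR (n%:R * - (eta / 4)^-1))).
      rewrite ler_pM2l ?exprn_gt0// ler_expR mulrN lerN2.
      rewrite mulrAC ler_pdivlMr// natrM /L.
      have -> : K%:R * K%:R / (eta / 4) * (m%:R * m%:R) =
                (m%:R * K%:R) * (m%:R * K%:R) / (eta / 4) by ring.
      rewrite mulrAC ler_pM2r ?invr_gt0; last by lra.
      by apply: ler_pM => //; exact: ltW.
    rewrite expRM_natl -exprMn.
    (* The failure probability is at most the [n]-th power of this quantity, hence at most
       [eta ^ n <= eta] as [n] is positive. *)
    have E : 4 * expR (- (eta / 4)^-1) <= eta.
      have : 0 < eta / 4 by lra.
      by move=> /expRN_invr_le; lra.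
    apply: (@le_trans _ _ (eta ^+ n)).
      by apply: lerXn2r => //; rewrite nnegrE ltW// mulr_gt0// expR_gt0.
    by rewrite -[leRHS]expr1 ler_wiXn2l// ?ltW//; lra.
  have S1 : 0 <= 1 - eta by lra.
  have m1le : K%:R * m1 <= eta * g n%:R^-1 by rewrite [leRHS]mulrC -ler_pdivrMr// ltW.
  have nm : (1 - eta) * n%:R <= (n - m)%:R.
    by rewrite natrB; [lra|by case/andP : mn].
  have : (1 - eta) * n%:R * ((1 - eta) * g n%:R^-1) * (1 - eta) <=
      (n - m)%:R * g (L / n%:R) * (1 - 4 ^+ n * expR (- (L / n%:R * (m * m)%:R))).
    apply: ler_pM => //; last by rewrite lerD2l lerN2.
      by rewrite !mulr_ge0// ltW.
    by apply: ler_pM => //; rewrite mulr_ge0// ltW.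
  (* The cost of the repaired rows is at most [n * K * m1] by [n <= m * K], and the threshold on [g]
     was chosen to give [K * m1 <= eta * g (1/n)]. *)
  have : m%:R^-1 * (n%:R * n%:R * m1) <= n%:R * (eta * g n%:R^-1).
    rewrite ler_pdivrMl//.
    apply: (@le_trans _ _ (n%:R * (m%:R * K%:R) * m1)).
      by rewrite ler_wpM2r// ler_pM2l.
    have -> : n%:R * (m%:R * K%:R) * m1 = m%:R * (n%:R * (K%:R * m1)) by ring.
    by rewrite !ler_pM2l.
  set G := g n%:R^-1; set A := (n - m)%:R * _ * _; set B := m%:R^-1 * _.
  have -> : (1 - eta) * n%:R * ((1 - eta) * G) * (1 - eta) =
     (1 - eta) ^+ 3 * (n%:R * G) by ring.
  move=> hB hA.
  have nG : 0 < n%:R * G by exact: mulr_gt0.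
  (* The three factors [1 - eta] come from the discarded rows, the lowered level and the failure
     probability; [(1 - eta)^3 - eta >= 1 - 4 * eta]. *)
  apply: (@le_trans _ _ (((1 - eta) ^+ 3 - eta) * (n%:R * G))).
    rewrite ler_pM2r//.
    have : 0 <= eta * eta * (3 - eta) by rewrite !mulr_ge0// ?ltW//; lra.
    have -> : (1 - eta) ^+ 3 = 1 - 3 * eta + eta * eta * (3 - eta) by ring.
    lra.
  rewrite mulrBl; apply: lerB => //.
  by apply: (le_trans hB); rewrite mulrCA.
apply: (le_trans h2); rewrite lee_fin mulrDl mul1r lerD2l.
apply: (@le_trans _ _ (eta * (n%:R * g n%:R^-1))); last first.
  by rewrite ler_pM2r ?mulr_gt0//; lra.
apply: (@le_trans _ _ (n%:R * n%:R * (eta / n%:R * g n%:R^-1))).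
  by rewrite ler_pM2l ?mulr_gt0.
have -> : n%:R * n%:R * (eta / n%:R * g n%:R^-1) = eta * (n%:R * g n%:R^-1).
  by field; rewrite gt_eqF.
by [].
Unshelve. all: by end_near. Qed.

End EventualBounds.

Theorem theorem1 (R : realType) (P : probability (measurableTypeR R) R)
  (hint : (\int[P]_x (`|x|)%:E < +oo)%E)
  (hinf : tail_quantile P p @[p --> 0^'+] --> +oo)
  (hslow : forall lam : R, 0 < lam ->
     (tail_quantile P (lam * p) / tail_quantile P p) @[p --> 0^'+] --> (1:R))
  (d1 : nat -> measure_display) (T1 : forall n, measurableType (d1 n))
  (Pr1 : forall n, probability (T1 n) R) (X : forall n, 'I_n -> T1 n -> R)
  (hX : forall n, iid_with_law (Pr1 n) (X n) P)
  (d2 : nat -> measure_display) (T2 : forall n, measurableType (d2 n))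
  (Pr2 : forall n, probability (T2 n) R)
  (Y : forall n, ('I_n * 'I_n)%type -> T2 n -> R)
  (hY : forall n, iid_with_law (Pr2 n) (Y n) P) :
  (exists e : nat -> R, e @ \oo --> (0:R) /\
     \forall n \near \oo,
       (\int[Pr1 n]_t (\big[Order.max/-oo]_(i < n) (X n i t)%:E))%E
       = (tail_quantile P n%:R^-1 * (1 + e n))%:E) /\
  (exists e : nat -> R, e @ \oo --> (0:R) /\
     \forall n \near \oo,
       (\int[Pr2 n]_t (\big[Order.max/-oo]_(s : 'S_n)
           (\sum_(i < n) Y n (i, s i) t)%:E))%E
       = (n%:R * tail_quantile P n%:R^-1 * (1 + e n))%:E).
Proof.
split.
  apply: (asymptotic_of_bounds _ (fun n => tail_quantile P n%:R^-1)) => e e0.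
  exact: mean_max_eventual.
apply: (asymptotic_of_bounds _ (fun n => n%:R * tail_quantile P n%:R^-1)) => e e0.
exact: mean_assignment_eventual.
Qed.
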